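(* Let $\mathbb{K}$ be a field and let $1\le k\le 3$. Then for infinitely many positive integers $n$ there exists a simplicial complex $J_{n,k}$ with $\Delta_{n-1}^{(k-1)}\subset J_{n,k}\subset\Delta_{n-1}^{(k)}$ such that $\tilde{\beta}_{k-2}(\mathrm{lk}(J_{n,k},v))=0$ for all vertices $v\in\Delta_{n-1}(0)$ and $$\tilde{\beta}_{k-1}(J_{n,k})=\frac{1}{k+1}\binom{n-2}{k}.$$
   Context: Simplicial complexes are finite abstract simplicial complexes containing the empty simplex (of dimension $-1$). $\Delta_{n-1}$ is the full simplex on the vertex set $[n]=\{0,\ldots,n-1\}$, $Y^{(j)}$ denotes the $j$-dimensional skeleton of a complex $Y$, and $Y(j)$ is the set of its $j$-dimensional simplices. For a simplex $\tau\in X$, the link is $\mathrm{lk}(X,\tau)=\{\sigma\in X: \sigma\cup\tau\in X,\ \sigma\cap\tau=\emptyset\}$; $\mathrm{lk}(X,v)$ means $\mathrm{lk}(X,\{v\})$. $\tilde{\beta}_j(Y)=\dim_{\mathbb{K}}\tilde{H}_j(Y;\mathbb{K})$ is the reduced Betti number over the fixed field $\mathbb{K}$; in particular $\tilde\beta_{-1}(\{\emptyset\})=1$ and $\tilde\beta_{-1}(Y)=0$ if $Y$ has a vertex. $\subset$ allows equality. *)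

(* Defs.v *)
From mathcomp Require Import all_boot all_order all_algebra.
Set Implicit Arguments.
Unset Strict Implicit.
Unset Printing Implicit Defensive.
Import GRing.Theory.
Local Open Scope ring_scope.

(* Dimensions are integers, so that the empty simplex has dimension -1. *)
Definition sdim (n : nat) (s : {set 'I_n}) : int := #|s|%:Z - 1.

Definition is_complex (n : nat) (X : {set {set 'I_n}}) : Prop :=
  set0 \in X /\ forall s t : {set 'I_n}, s \in X -> t \subset s -> t \in X.

Definition full_simplex (n : nat) : {set {set 'I_n}} := [set: {set 'I_n}].

Definition skeleton (n : nat) (X : {set {set 'I_n}}) (j : int) :
  {set {set 'I_n}} := [set s in X | sdim s <= j].

Definition faces (n : nat) (X : {set {set 'I_n}}) (j : int) :
  {set {set 'I_n}} := [set s in X | sdim s == j].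

Definition link (n : nat) (X : {set {set 'I_n}}) (t : {set 'I_n}) :
  {set {set 'I_n}} := [set s in X | (s :|: t \in X) && (s :&: t == set0)].

(* Coefficient of t in the oriented boundary of s, where every simplex is
   oriented by the order of 'I_n: it is (-1)^i if t is obtained from s by
   deleting its i-th smallest vertex (counting from 0), and 0 otherwise. *)
Definition incidence (K : fieldType) (n : nat) (s t : {set 'I_n}) : K :=
  \sum_(v in s | t == s :\ v) (-1) ^+ #|[set u in s | (u < v)%N]|.

(* Chains are row vectors over the faces, so for i = j + 1 this is the matrix
   of the boundary map C_i -> C_j acting on the right. Separate i and j make
   consecutive boundary matrices composable without casts. *)
Definition boundary (K : fieldType) (n : nat) (X : {set {set 'I_n}})
    (i j : int) : 'M[K]_(#|faces X i|, #|faces X j|) :=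
  \matrix_(a, b) incidence K (enum_val a) (enum_val b).

(* Reduced homology: C_(-1) is spanned by the empty simplex, so the boundary
   of vertices is the augmentation. The quotient cycles / boundaries is
   realised as a complement of the boundaries in the space of cycles. *)
Definition betti (K : fieldType) (n : nat) (X : {set {set 'I_n}}) (j : int) :
  nat := \rank (kermx (boundary K X j (j - 1)) :\: boundary K X (j + 1) j)%MS.

(* Main.v *)
Require Import Defs.
From mathcomp Require Import all_boot all_order all_algebra.
From mathcomp Require Import zify.
Set Implicit Arguments.
Unset Strict Implicit.
Unset Printing Implicit Defensive.
Import GRing.Theory.
Local Open Scope ring_scope.

(* Let J contain all simplices of dimension < k and a family F of k-simplices.
   If the (k-1)-dimensional facets of each link lk(v) are in bijection with the
   (k-1)-subsets of V \ {v, w}, for some w, by a bijection s |-> {g(s)} u s which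
   is triangular for inclusion, then the top boundary map of lk(v) is injective
   and lk(v) has C(n-2, k-1) facets; comparing with the rank of the boundary
   maps of the full simplex, its Betti number in dimension k-2 vanishes. The
   link of v in a k-cycle of J is a (k-1)-cycle of lk(v), so J has no k-cycles,
   and its Betti number in dimension k-1 is C(n-1, k) - |F| where, counting
   flags, (k+1) |F| = n C(n-2, k-1).

   Facets, for k = 1 and k = 3: with a fixed-point-free involution "flip" and a
   sign changed by it, take {x, flip x}, respectively all {x, flip x, y, z}
   with z = flip y or y, z of the same sign. For k = 2: on Z/3 x [m], with
   "rot" the rotation of the first coordinate (the colour), take {x, rot x, y}
   with y = rot (rot x), or y above x and of the colour of x, or y below x and
   of the third colour. *)

(** * Boundary maps of full skeleta *)

Section Incidence.
Variables (K : fieldType) (n : nat).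
Implicit Types (s t : {set 'I_n}) (A B : {set {set 'I_n}}).

Lemma setD1_inj s u v : u \in s -> s :\ u = s :\ v -> u = v.
Proof.
by move=> us /setP /(_ u); rewrite !inE eqxx us andbT /=; case: eqP.
Qed.

Lemma incidence_setD1 s v : v \in s ->
  incidence K s (s :\ v) = (-1) ^+ #|[set u in s | (u < v)%N]|.
Proof.
move=> vs; rewrite /incidence (big_pred1 v) // => u /=.
apply/andP/eqP => [[us /eqP/esym E]|->]; last by [].
exact: setD1_inj E.
Qed.

Lemma incidence_neq0P s t :
  reflect (exists2 v, v \in s & t = s :\ v) (incidence K s t != 0).
Proof.
apply: (iffP idP) => [|[v vs ->]].
  case: (pickP (fun v => (v \in s) && (t == s :\ v))) => [v|noV].
    by case/andP=> vs /eqP; exists v.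
  by rewrite /incidence big_pred0 ?eqxx.
by rewrite incidence_setD1 // signr_eq0.
Qed.

Lemma incidence_setU1 s v : v \notin s -> incidence K (v |: s) s != 0.
Proof.
move=> vs; apply/incidence_neq0P; exists v; first exact: setU11.
by rewrite setU1K.
Qed.

Lemma card_below_setD1 s (u v : 'I_n) : u \in s ->
  #|[set x in s | (x < v)%N]| =
  ((u < v)%N + #|[set x in s :\ u | (x < v)%N]|)%N.
Proof.
move=> us; rewrite (cardsD1 u) inE us /=; congr (_ + #|pred_of_set _|)%N.
by apply/setP => x; rewrite !inE andbA.
Qed.

(** Two vertices can be deleted in either order, with opposite signs, so a boundary of a boundary
    cancels in pairs. *)
Lemma incidence_comp s t :
  \sum_(m : {set 'I_n}) incidence K s m * incidence K m t = 0.
Proof.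
pose sg (s : {set 'I_n}) (v : 'I_n) : K := (-1) ^+ #|[set x in s | (x < v)%N]|.
pose P (p : 'I_n * 'I_n) :=
  [&& p.1 \in s, p.2 \in s :\ p.1 & t == s :\ p.1 :\ p.2].
pose G (p : 'I_n * 'I_n) := sg s p.1 * sg (s :\ p.1) p.2.
have -> : \sum_(m : {set 'I_n}) incidence K s m * incidence K m t =
          \sum_(p | P p) G p.
  transitivity (\sum_(v in s) sg s v * incidence K (s :\ v) t).
    under eq_bigr => m _ do rewrite {1}/incidence mulr_suml.
    rewrite (exchange_big_dep (fun v => v \in s)) /=; last first.
      by move=> m v _ /andP[].
    apply: eq_bigr => v vs; rewrite (big_pred1 (s :\ v)) // => m.
    by rewrite vs /=.
  under eq_bigr => v _ do rewrite /incidence mulr_sumr.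
  by rewrite pair_big_dep.
(* Split the ordered pairs of deleted vertices by which is smaller and swap the coordinates in one
   half; [P] is symmetric and excludes the diagonal. *)
rewrite (bigID (fun p : 'I_n * 'I_n => (p.1 < p.2)%N)) /= addrC.
pose sw (p : 'I_n * 'I_n) := (p.2, p.1).
have swK : involutive sw by case.
rewrite (reindex_inj (inv_inj swK)) /=.
rewrite (eq_bigl (fun p => P p && (p.1 < p.2)%N)); last first.
  case=> u v; rewrite /P /= !inE; case: (ltngtP u v) => uv;
    rewrite ?andbF ?andbT //; first last.
    by move/val_inj: uv => ->; rewrite eqxx /= !andbF.
  rewrite setDDl setUC -setDDl; case: eqVneq => _; first by rewrite !andbF.
  by rewrite andbCA.
rewrite -big_split big1 //= => -[u v] /andP[/and3P[/= us]].
rewrite !inE => /andP[vu vs] _ uv.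
(* For [u < v], deleting [u] first lowers the position of [v] by one, while deleting [v] first
   leaves that of [u]. *)
rewrite /G /sg /= (card_below_setD1 v us) (card_below_setD1 u vs) uv ltnNge ltnW //=.
by rewrite add0n add1n exprS mulN1r mulNr mulrC addNr.
Qed.

(** [boundary K X i j] is the case of [faces X i] and [faces X j]; arbitrary families allow the rows
    to be restricted. *)
Definition incidence_mx A B : 'M[K]_(#|A|, #|B|) :=
  \matrix_(a, b) incidence K (enum_val a) (enum_val b).

(** Every facet of a member of [A] lies in [B], so the sum over [B] is the full sum of
    [incidence_comp]. *)
Lemma incidence_mx_comp (A B C : {set {set 'I_n}}) :
  (forall s v, s \in A -> v \in s -> s :\ v \in B) ->
  incidence_mx A B *m incidence_mx B C = 0.
Proof.
move=> AB; apply/matrixP => a c; rewrite !mxE.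
under eq_bigr => b _ do rewrite !mxE.
rewrite -(big_enum_val (fun m => incidence K (enum_val a) m *
  incidence K m (enum_val c))) /=.
rewrite -[RHS](incidence_comp (enum_val a) (enum_val c)).
rewrite [RHS](bigID (mem B)) /= [X in _ + X]big1 ?addr0 // => m mB.
have [->|/incidence_neq0P[v vs mE]] := eqVneq (incidence K (enum_val a) m) 0.
  by rewrite mul0r.
by rewrite mE AB ?enum_valP in mB.
Qed.

(** Collapsing, by strong induction on [r]: in the cycle equation at [bot i], every term other than
    that of [top i] belongs to some [top j] of smaller [r], where [x] already vanishes. *)
Lemma cycle_vanishes A B (x : {set 'I_n} -> K) (I : finType) (D : {set I})
    (top bot : I -> {set 'I_n}) (r : I -> nat) :
  {in B, forall b, \sum_(a in A) x a * incidence K a b = 0} ->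
  {in D, forall i, [/\ top i \in A, bot i \in B
                     & incidence K (top i) (bot i) != 0]} ->
  {in D, forall i, {in A, forall a : {set 'I_n}, bot i \subset a ->
     a = top i \/ exists j, [/\ j \in D, a = top j & (r j < r i)%N]}} ->
  {in D, forall i, x (top i) = 0}.
Proof.
move=> cyc mem_top tri i; have [k] := ubnP (r i).
elim: k i => // k IH i ri iD; have [tA bB inc] := mem_top i iD.
have := cyc _ bB; rewrite (bigD1 (top i)) //= big1 ?addr0 => [/eqP|a].
  by rewrite mulf_eq0 (negPf inc) orbF => /eqP.
case/andP=> aA ne.
have [->|/incidence_neq0P[v _ bE]] := eqVneq (incidence K a (bot i)) 0.
  by rewrite mulr0.
have sub : bot i \subset a by rewrite bE subD1set.
have [aE|[j [jD -> rj]]] := tri i iD a aA sub; first by rewrite aE eqxx in ne.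
by rewrite (IH j) ?mul0r //; apply: leq_trans rj _.
Qed.

Lemma row_free_incidence_mx A B :
  (forall x : {set 'I_n} -> K,
     {in B, forall b, \sum_(a in A) x a * incidence K a b = 0} ->
     {in A, forall a, x a = 0}) ->
  row_free (incidence_mx A B).
Proof.
move=> van; rewrite -kermx_eq0; apply/rowV0P => u /sub_kermxP u0.
(* [x] reads the row vector [u] as a function on sets, equal to 0 outside [A]. *)
pose x s := \sum_(i | enum_val i == s) u 0 i.
have xE i : x (enum_val i) = u 0 i.
  by rewrite /x (big_pred1 i) // => j; rewrite (inj_eq enum_val_inj).
apply/rowP => i; rewrite mxE -xE; apply: van (enum_valP i) => b bB.
have /rowP/(_ (enum_rank_in bB b)) := u0.
rewrite !mxE => ub; rewrite -[RHS]ub big_enum_val /=; apply: eq_bigr => j _.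
by rewrite xE mxE enum_rankK_in.
Qed.

Lemma rank_incidence_mxS (A A' B : {set {set 'I_n}}) : A' \subset A ->
  (\rank (incidence_mx A' B) <= \rank (incidence_mx A B))%N.
Proof.
move=> sAA; apply: mxrankS; apply/row_subP => i.
have iA : enum_val i \in A by apply: (subsetP sAA); apply: enum_valP.
have -> : row i (incidence_mx A' B) =
          row (enum_rank_in iA (enum_val i)) (incidence_mx A B).
  by apply/rowP => j; rewrite !mxE enum_rankK_in.
exact: row_sub.
Qed.

Definition subsets_of_card (W : {set 'I_n}) (i : nat) : {set {set 'I_n}} :=
  [set s : {set 'I_n} | (s \subset W) && (#|s| == i)].

(* Stands for [subsets_of_card W i.-1], but is empty for [i = 0]. *)
Definition subsets_of_pred_card (W : {set 'I_n}) (i : nat) : {set {set 'I_n}} :=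
  [set s : {set 'I_n} | (s \subset W) && (#|s|.+1 == i)].

Lemma subsets_of_pred_cardS W i :
  subsets_of_pred_card W i.+1 = subsets_of_card W i.
Proof. by apply/setP => s; rewrite !inE eqSS. Qed.

Lemma card_subsets_of_card W i : #|subsets_of_card W i| = 'C(#|W|, i).
Proof. exact: cards_draws. Qed.

Lemma setD1_subsets_of_card W i s v : s \in subsets_of_card W i.+1 -> v \in s ->
  s :\ v \in subsets_of_card W i.
Proof.
rewrite !inE => /andP[sW /eqP si] vs; rewrite (subset_trans (subD1set _ _) sW).
by rewrite (cardsD1 v) vs add1n in si; case: si => ->; rewrite eqxx.
Qed.

(** The [i]-subsets through [w] have independent boundaries: [s] is the only one of them that
    contains [s :\ w]. *)
Lemma rank_full_ge (W : {set 'I_n}) i w : w \in W ->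
  ('C(#|W|, i) <= 'C(#|W|.-1, i) +
     \rank (incidence_mx (subsets_of_card W i) (subsets_of_pred_card W i)))%N.
Proof.
move=> wW; pose A := [set s in subsets_of_card W i | w \in s].
have sA : A \subset subsets_of_card W i by apply/subsetP => s; rewrite inE => /andP[].
have cardA : ('C(#|W|, i) = 'C(#|W|.-1, i) + #|A|)%N.
  have -> : #|W|.-1 = #|W :\ w| by rewrite [in LHS](cardsD1 w) wW.
  rewrite -!cards_draws -/(subsets_of_card W i) -(cardsID [set s : {set 'I_n} | w \in s]) addnC.
  congr (_ + _)%N; apply: eq_card => s; rewrite !inE ?subsetD1.
    by rewrite andbC andbAC.
  by [].
rewrite cardA leq_add2l; apply: leq_trans (rank_incidence_mxS _ sA).
have /eqP -> // : row_free (incidence_mx A (subsets_of_pred_card W i)).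
apply: row_free_incidence_mx => x cyc.
apply: (@cycle_vanishes _ _ x _ A id (fun s : {set 'I_n} => s :\ w) (fun=> 0%N) cyc).
  move=> s sIn; split=> //; move: sIn; rewrite !inE -andbA => /and3P[sW si ws].
    by rewrite (subset_trans (subD1set _ _) sW) -(eqP si) [X in _ == X](cardsD1 w) ws eqxx.
  by apply/incidence_neq0P; exists w.
move=> s; rewrite !inE -andbA => /and3P[_ /eqP si ws] t.
rewrite !inE -andbA => /and3P[_ /eqP ti wt] sub; left; apply/esym/eqP.
rewrite eqEcard si ti leqnn andbT; apply/subsetP => u us.
by case: (eqVneq u w) => [-> //|uw]; apply: (subsetP sub); rewrite !inE uw.
Qed.

(** This is the acyclicity of the full simplex. The composite of consecutive boundaries is 0, so
    their ranks add up to at most ['C(#|W|, i)]; the lower bound for [i.+1] and Pascal's rule then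
    bound the rank for [i] from above. *)
Lemma rank_full (W : {set 'I_n}) i w : w \in W ->
  ('C(#|W|.-1, i) +
     \rank (incidence_mx (subsets_of_card W i) (subsets_of_pred_card W i)))%N
  = 'C(#|W|, i).
Proof.
move=> wW; apply/eqP; rewrite eqn_leq (rank_full_ge _ wW) andbT.
have := rank_full_ge i.+1 wW; rewrite subsets_of_pred_cardS.
have comp0 : incidence_mx (subsets_of_card W i.+1) (subsets_of_card W i) *m
   incidence_mx (subsets_of_card W i) (subsets_of_pred_card W i) = 0.
  exact/incidence_mx_comp/setD1_subsets_of_card.
have := mulmx0_rank_max comp0; have := card_subsets_of_card W i.
have : (0 < #|W|)%N by apply/card_gt0P; exists w.
case: #|W| => // N _ /=; rewrite binS; lia.
Qed.

(** Here [i] counts vertices, so the homology is in dimension [i - 1]. By [rank_full] the cycles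
    have dimension ['C(#|W|.-1, i)], and freeness makes each top face contribute one dimension of
    boundaries. *)
Lemma betti_full_skeleton (X : {set {set 'I_n}}) (W : {set 'I_n}) (i : nat) w :
  w \in W ->
  faces X (i%:Z - 1) = subsets_of_card W i ->
  faces X (i%:Z - 1 - 1) = subsets_of_pred_card W i ->
  faces X i%:Z \subset subsets_of_card W i.+1 ->
  row_free (incidence_mx (faces X i%:Z) (subsets_of_card W i)) ->
  (betti K X (i%:Z - 1) + #|faces X i%:Z|)%N = 'C(#|W|.-1, i).
Proof.
move=> wW Xi Xp sX /eqP free; rewrite /betti subrK.
have bE j l : boundary K X j l = incidence_mx (faces X j) (faces X l) by [].
rewrite !bE Xi Xp.
set M := incidence_mx (subsets_of_card W i) _; set L := incidence_mx _ _ in free *.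
have LM : (L <= kermx M)%MS.
  apply/sub_kermxP/incidence_mx_comp => s v /(subsetP sX).
  exact: setD1_subsets_of_card.
have := mxrank_cap_compl (kermx M) L; rewrite (capmx_idPr LM) free mxrank_ker.
have := rank_full i wW; rewrite -/M.
have := rank_leq_row M; have := card_subsets_of_card W i; lia.
Qed.

End Incidence.

(** * Complexes whose vertex links are hypertrees *)

Lemma sdim_eq n (s : {set 'I_n}) (i : nat) : (sdim s == i%:Z - 1) = (#|s| == i).
Proof. by rewrite /sdim; apply/eqP/eqP; lia. Qed.

Lemma sdim_eq_pred n (s : {set 'I_n}) (i : nat) :
  (sdim s == i%:Z - 1 - 1) = (#|s|.+1 == i).
Proof. by rewrite /sdim; apply/eqP/eqP; lia. Qed.

Lemma sdim_eqS n (s : {set 'I_n}) (i : nat) : (sdim s == i%:Z) = (#|s| == i.+1).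
Proof. by rewrite /sdim; apply/eqP/eqP; lia. Qed.

Lemma setU1_inj (T : finType) (v : T) (s t : {set T}) :
  v \notin s -> v \notin t -> v |: s = v |: t -> s = t.
Proof. by move=> vs vt st; rewrite -(setU1K vs) st setU1K. Qed.

(* [s |-> v |: (g s |: s)] is a bijection onto the facets through [v], and
   removing the facets of the link by increasing height [r] collapses each
   [g s |: s] through its face [s]. *)
Definition tree_link n d (F : {set {set 'I_n}}) (v w : 'I_n)
    (g : {set 'I_n} -> 'I_n) (r : {set 'I_n} -> nat) : Prop :=
  let D := subsets_of_card (~: [set v; w]) d in
  [/\ w != v,
      [set a in F | v \in a] = [set v |: (g s |: s) | s in D],
      {in D, forall s : {set 'I_n}, g s \notin v |: s}
    & {in D &, forall s t : {set 'I_n}, s \subset g t |: t -> s = t \/ (r t < r s)%N}].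

Section Criterion.
Variables (K : fieldType) (n d : nat) (F : {set {set 'I_n}}).
Hypothesis sF : F \subset subsets_of_card [set: 'I_n] d.+2.
Hypothesis n_gt0 : (0 < n)%N.
Hypothesis trF : forall v, exists w g r, tree_link d F v w g r.

(** In this section k is [d.+1]: simplices of [F] have [d.+2] vertices, and the ridges [s] of a link
    in [tree_link] have [d]. *)
Definition with_skeleton : {set {set 'I_n}} :=
  [set s : {set 'I_n} | (#|s| <= d.+1)%N] :|: F.
Local Notation J := with_skeleton.

Lemma card_facet a : a \in F -> #|a| = d.+2.
Proof. by move/(subsetP sF); rewrite !inE => /andP[_ /eqP]. Qed.

Lemma in_with_skeleton (s : {set 'I_n}) :
  (s \in J) = if #|s| == d.+2 then s \in F else (#|s| <= d.+1)%N.
Proof.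
rewrite !inE; have [sF'|sNF] := boolP (s \in F).
  by rewrite card_facet // eqxx orbT.
rewrite orbF; case: eqP => // ->; lia.
Qed.

Lemma is_complex_with_skeleton : is_complex J.
Proof.
split=> [|s t sJ ts]; first by rewrite in_with_skeleton cards0.
have [E|ne] := eqVneq t s; first by rewrite E.
have lt : (#|t| < #|s|)%N by rewrite proper_card // properEneq ne.
have le : (#|s| <= d.+2)%N.
  by move: sJ; rewrite in_with_skeleton; case: eqP => [->|] //; lia.
rewrite in_with_skeleton; case: eqP => [E|_]; lia.
Qed.

Lemma faces_with_skeleton_top : faces J d.+1%:Z = F.
Proof.
apply/setP => s; rewrite inE sdim_eqS in_with_skeleton.
case: eqP => [_|ne]; first by rewrite andbT.
by rewrite andbF; apply/esym/negP => /card_facet.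
Qed.

Lemma faces_with_skeleton_ridge :
  faces J (d.+1%:Z - 1) = subsets_of_card [set: 'I_n] d.+1.
Proof.
apply/setP => s; rewrite !inE subsetT sdim_eq.
case: eqP => [E|]; rewrite ?andbF //= andbT.
by rewrite E leqnn.
Qed.

Lemma faces_with_skeleton_pred :
  faces J (d.+1%:Z - 1 - 1) = subsets_of_pred_card [set: 'I_n] d.+1.
Proof.
apply/setP => s; rewrite !inE subsetT sdim_eq_pred.
case: eqP => [[E]|]; rewrite ?andbF //= andbT.
by rewrite E leqnSn.
Qed.

Lemma in_link (v : 'I_n) (s : {set 'I_n}) : (#|s| <= d.+1)%N ->
  (s \in link J [set v]) = (v |: s \in J) && (v \notin s).
Proof.
move=> le; rewrite [LHS]inE setUC (_ : s \in J) /=; last first.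
  by rewrite in_with_skeleton; case: eqP => // E; move: le; rewrite E; lia.
by rewrite setI_eq0 disjoint_sym disjoints1.
Qed.

Lemma faces_link_top (v : 'I_n) (s : {set 'I_n}) :
  (s \in faces (link J [set v]) d%:Z) = (v \notin s) && (v |: s \in F).
Proof.
rewrite inE sdim_eqS; have [vs|vs] := boolP (v \in s).
  rewrite /=; apply/negbTE; rewrite !inE negb_and negb_and negb_and.
  by rewrite (_ : s :&: [set v] != set0) ?orbT //; apply/set0Pn; exists v; rewrite !inE vs eqxx.
rewrite /=; case: eqP => [E|ne].
  by rewrite in_link ?E // in_with_skeleton cardsU1 vs E eqxx !andbT.
rewrite andbF; apply/esym/negP => /card_facet.
by rewrite cardsU1 vs => -[].
Qed.

Lemma faces_link_low (v : 'I_n) (s : {set 'I_n}) : (#|s| <= d)%N ->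
  (s \in link J [set v]) = (s \subset ~: [set v]).
Proof.
move=> le; rewrite in_link; last exact: leqW.
rewrite subsetC sub1set in_setC andbC; case: (boolP (v \in s)) => // vs /=.
rewrite in_with_skeleton cardsU1 vs add1n eqSS; case: eqP => //; lia.
Qed.

Lemma faces_link_ridge (v : 'I_n) :
  faces (link J [set v]) (d%:Z - 1) = subsets_of_card (~: [set v]) d.
Proof.
apply/setP => s; rewrite in_set [RHS]in_set sdim_eq.
case: eqP => [E|_]; last by rewrite !andbF.
rewrite !andbT.
by rewrite faces_link_low ?E.
Qed.

Lemma faces_link_pred (v : 'I_n) :
  faces (link J [set v]) (d%:Z - 1 - 1) = subsets_of_pred_card (~: [set v]) d.
Proof.
apply/setP => s; rewrite in_set [RHS]in_set sdim_eq_pred.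
case: eqP => [E|_]; last by rewrite !andbF.
rewrite !andbT.
by rewrite faces_link_low -?E.
Qed.

(** * The link of one vertex *)

Section Link.
Variables (v w : 'I_n) (g : {set 'I_n} -> 'I_n) (r : {set 'I_n} -> nat).
Hypothesis trv : tree_link d F v w g r.
Let D := subsets_of_card (~: [set v; w]) d.

(** If two distinct ridges had the same image, each would lie in the facet of the other, and
    triangularity would give [r t < r s < r t]. *)
Lemma tree_link_inj : {in D &, injective (fun s => g s |: s)}.
Proof.
have [_ _ _ tri] := trv => s t sD tD st.
have [|//|ts] := tri s t sD tD; first by rewrite -st subsetUr.
have [|//|] := tri t s tD sD; first by rewrite st subsetUr.
by move/(ltn_trans ts); rewrite ltnn.
Qed.

Lemma notin_ridge s : s \in D -> v \notin s.
Proof.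
by rewrite inE => /andP[/subsetP sub _]; apply/negP => /sub; rewrite !inE eqxx.
Qed.

Lemma notin_link_facet s : s \in D -> v \notin g s |: s.
Proof.
have [_ _ gN _] := trv; move=> sD; move: (gN s sD).
by rewrite !inE !negb_or eq_sym => /andP[-> _]; apply: notin_ridge.
Qed.

Lemma facetP a : reflect (exists2 s, s \in D & a = v |: (g s |: s))
  ((a \in F) && (v \in a)).
Proof.
have [_ FE _ _] := trv; have -> : (a \in F) && (v \in a) = (a \in [set a in F | v \in a]).
  by rewrite inE.
by rewrite FE; apply: imsetP.
Qed.

Lemma link_facetP a : reflect (exists2 s, s \in D & a = g s |: s)
  (a \in faces (link J [set v]) d%:Z).
Proof.
rewrite faces_link_top; apply: (iffP andP) => [[va vaF]|[s sD ->]].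
  have /facetP[s sD E] : (v |: a \in F) && (v \in v |: a) by rewrite vaF setU11.
  by exists s; rewrite // (setU1_inj _ _ E) ?notin_link_facet.
rewrite notin_link_facet //; split=> //.
suff /andP[] : (v |: (g s |: s) \in F) && (v \in v |: (g s |: s)) by [].
by apply/facetP; exists s.
Qed.

Lemma card_ridges : #|D| = 'C(n - 2, d).
Proof.
have [wv _ _ _] := trv; rewrite card_subsets_of_card; congr 'C(_, _).
by rewrite cardsCs setCK card_ord cards2 eq_sym wv.
Qed.

Lemma card_facets_at : #|[set a in F | v \in a]| = 'C(n - 2, d).
Proof.
have [_ -> _ _] := trv; rewrite card_in_imset ?card_ridges // => s t sD tD st.
by apply: tree_link_inj => //; apply: setU1_inj st; apply: notin_link_facet.
Qed.

Lemma card_link_facets : #|faces (link J [set v]) d%:Z| = 'C(n - 2, d).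
Proof.
rewrite -card_ridges -(card_in_imset tree_link_inj); congr #|pred_of_set _|.
apply/setP => a; apply/link_facetP/imsetP => -[s sD ->]; by exists s.
Qed.

Lemma incidence_ridge s : s \in D -> incidence K (g s |: s) s != 0.
Proof.
have [_ _ gN _] := trv; move=> sD; apply: incidence_setU1.
by apply: contra (gN s sD); apply: setU1r.
Qed.

(** The link collapses: each facet [g s |: s] is paired with its face [s]. *)
Lemma row_free_link :
  row_free (incidence_mx K (faces (link J [set v]) d%:Z)
                           (subsets_of_card (~: [set v]) d)).
Proof.
have [_ _ _ tri] := trv; apply: row_free_incidence_mx => x cyc a /link_facetP[s0 s0D ->].
apply: (@cycle_vanishes _ _ _ _ x _ D (fun s => g s |: s) id r cyc) s0D.
  move=> s sD; split; last exact: incidence_ridge.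
    by apply/link_facetP; exists s.
  move: (notin_ridge sD) (sD); rewrite !inE => vs /andP[_ ->].
  by rewrite andbT subsetC sub1set inE.
move=> s sD a' /link_facetP[t tD ->] /= sub.
by have [->|lt] := tri s t sD tD sub; [left | right; exists t].
Qed.

(** The collapse of the link, coned with [v]: the facet [v |: (g s |: s)] is paired with [v |: s].
    Only the cycle equations at faces through [v] are involved, which are those of the link. *)
Lemma cycle_vanishes_at (x : {set 'I_n} -> K) :
  {in subsets_of_card [set: 'I_n] d.+1,
     forall b, \sum_(a in F) x a * incidence K a b = 0} ->
  {in F, forall a : {set 'I_n}, v \in a -> x a = 0}.
Proof.
have [_ _ gN tri] := trv; move=> cyc a aF va.
have /facetP[s0 s0D ->] : (a \in F) && (v \in a) by rewrite aF.
apply: (@cycle_vanishes _ _ _ _ x _ D (fun s => v |: (g s |: s)) (fun s => v |: s) r cyc) s0D.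
  move=> s sD; split.
  - suff /andP[] : (v |: (g s |: s) \in F) && (v \in v |: (g s |: s)) by [].
    by apply/facetP; exists s.
  - move: (notin_ridge sD) (sD); rewrite !inE => vs /andP[_ /eqP E].
    by rewrite subsetT cardsU1 vs E add1n eqxx.
  - by rewrite setUCA; apply: incidence_setU1; apply: gN.
move=> s sD a' a'F sub.
have va' : v \in a' by rewrite (subsetP sub) ?setU11.
have /facetP[t tD E] : (a' \in F) && (v \in a') by rewrite a'F.
have sub' : s \subset g t |: t.
  apply/subsetP => u us; have : u \in a' by rewrite (subsetP sub) ?setU1r.
  rewrite E in_setU1 => /predU1P[uv|//].
  by have := notin_ridge sD; rewrite -uv us.
by have [->|lt] := tri s t sD tD sub'; [left | right; exists t].
Qed.

(** On the [n - 1] vertices other than [v], the cycles have dimension ['C(n - 2, d)], which is also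
    the number of independent link facets. *)
Lemma betti_link : betti K (link J [set v]) (d%:Z - 1) = 0%N.
Proof.
have [wv _ _ _] := trv.
have wW : w \in ~: [set v] by rewrite !inE.
have sL : faces (link J [set v]) d%:Z \subset subsets_of_card (~: [set v]) d.+1.
  apply/subsetP => s; rewrite faces_link_top !inE => /andP[vs /card_facet].
  by rewrite cardsU1 vs add1n => -[->]; rewrite eqxx andbT subsetC sub1set inE.
have := betti_full_skeleton wW (faces_link_ridge v) (faces_link_pred v) sL row_free_link.
rewrite card_link_facets cardsCs setCK card_ord cards1 -subn1 -subnDA addn1.
lia.
Qed.

End Link.

(** * From the links to the whole complex *)

Lemma row_free_facets :
  row_free (incidence_mx K F (subsets_of_card [set: 'I_n] d.+1)).
Proof.
apply: row_free_incidence_mx => x cyc a aF.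
have /card_gt0P[v va] : (0 < #|a|)%N by rewrite card_facet.
have [w [g [r trv]]] := trF v.
exact: (cycle_vanishes_at trv cyc).
Qed.

Lemma card_facets : (d.+2 * #|F| = n * 'C(n - 2, d))%N.
Proof.
have <- : (\sum_(a in F) #|a| = d.+2 * #|F|)%N.
  by rewrite (eq_bigr _ card_facet) sum_nat_const mulnC.
under eq_bigr => a _ do rewrite -sum1_card.
rewrite (exchange_big_dep predT) //=.
transitivity (\sum_(v < n) 'C(n - 2, d))%N; last first.
  by rewrite sum_nat_const card_ord.
apply: eq_bigr => v _; have [w [g [r trv]]] := trF v.
by rewrite -(card_facets_at trv) -sum1_card; apply: eq_bigl => a; rewrite inE.
Qed.

Lemma betti_with_skeleton : (d.+2 * betti K J (d.+1%:Z - 1) = 'C(n - 2, d.+1))%N.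
Proof.
pose v := Ordinal n_gt0; have [w [g [r [wv _ _ _]]]] := trF v.
have n_gt1 : (1 < n)%N.
  have := ltn_ord w; have : (0 < w)%N by move: wv; rewrite lt0n.
  lia.
have := @betti_full_skeleton K n J [set: 'I_n] d.+1 v (in_setT v)
  faces_with_skeleton_ridge faces_with_skeleton_pred.
rewrite faces_with_skeleton_top => /(_ sF row_free_facets).
rewrite cardsT card_ord.
have := card_facets; have := mul_bin_left (n - 2) d.
move: n_gt1; set b := betti K _ _; set f := #|F|.
move: b f; case: (n) => [|[|N]] // b f _; rewrite !subSS subn0 /= binS.
have /implyP : (N < d)%N ==> ('C(N, d) == 0%N) by apply/implyP => /bin_small ->.
move: 'C(N, d.+1) 'C(N, d) => c1 c c0.
(* For [N < d] the subtraction [N - d] in the binomial identity is truncated, but [c] is 0 and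
   forces [c1], [f] and [b] to be 0. *)
have [ltN|leN] := ltnP N d; first rewrite (eqP (c0 ltN)) !muln0 addn0.
  move=> /eqP; rewrite muln_eq0 => /eqP -> /eqP; rewrite muln_eq0 => /eqP ->.
  by rewrite addn0 => ->; rewrite muln0.
have [e ->] : exists e, N = (d + e)%N by exists (N - d)%N; rewrite subnKC.
(* Substituting (d+1) c1 = e c and (d+2) f = (d+e+2) c into (d+2)(b+f) = (d+2)(c1+c) leaves (d+2) b
   = c1. *)
rewrite addKn => h1 h2 /(congr1 (muln d.+2)); nia.
Qed.

Lemma with_skeleton_spec :
  [/\ is_complex J,
      skeleton (full_simplex n) (d.+1%:Z - 1) \subset J,
      J \subset skeleton (full_simplex n) d.+1%:Z,
      forall v : 'I_n, betti K (link J [set v]) (d.+1%:Z - 2) = 0%N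
    & (betti K J (d.+1%:Z - 1))%:R
      = 1 / (d.+2)%:R * 'C(n - 2, d.+1)%:R :> rat].
Proof.
split.
- exact: is_complex_with_skeleton.
- apply/subsetP => s; rewrite !inE /sdim /= => le; apply/orP; left; lia.
- apply/subsetP => s; rewrite !inE /sdim /= => /orP[|/card_facet ->]; lia.
- move=> v; have [w [g [r trv]]] := trF v.
  rewrite (_ : d.+1%:Z - 2 = d%:Z - 1); [exact: betti_link trv | lia].
- rewrite -betti_with_skeleton natrM mulrA mul1r mulVf ?mul1r //.
  by rewrite Num.Theory.pnatr_eq0.
Qed.

End Criterion.

(** * Facets for k = 1 and k = 3 *)

Section Antipodal.
Variables (n : nat) (flip : 'I_n -> 'I_n) (sg : 'I_n -> bool).
Hypotheses (flipK : involutive flip) (sg_flip : forall x, sg (flip x) = ~~ sg x).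

Lemma flip_neq x : (flip x == x) = false.
Proof. by apply/eqP => /(congr1 sg); rewrite sg_flip; case: (sg x). Qed.

Definition matching : {set {set 'I_n}} := [set [set x; flip x] | x : 'I_n].

Lemma matching_card : matching \subset subsets_of_card [set: 'I_n] 2.
Proof.
apply/subsetP => _ /imsetP[x _ ->]; by rewrite inE subsetT cards2 [x == _]eq_sym flip_neq.
Qed.

(** The only ridge is the empty set, and the link of [v] is the single point [flip v]. *)
Lemma matching_tree v :
  tree_link 0 matching v (flip v) (fun=> flip v) (fun=> 0%N).
Proof.
have D0 (s : {set 'I_n}) : (s \in subsets_of_card (~: [set v; flip v]) 0) = (s == set0).
  by rewrite inE cards_eq0; case: eqP => [->|]; rewrite ?sub0set ?andbF.
split; first by rewrite flip_neq.
- apply/setP => a; rewrite inE; apply/andP/imsetP => [[/imsetP[x _ ->]]|[s]].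
    rewrite !inE => vx; exists set0; first by rewrite D0.
    by case/orP: vx => /eqP ->; rewrite ?flipK setU0 // setUC.
  rewrite D0 => /eqP -> ->; rewrite setU0 setU11; split=> //.
  by apply/imsetP; exists v.
- by move=> s; rewrite D0 => /eqP ->; rewrite !inE orbF flip_neq.
- by move=> s t; rewrite !D0 => /eqP -> /eqP ->; left.
Qed.

Definition quad_cond (x y z : 'I_n) : bool :=
  [&& y \notin [set x; flip x], z \notin [set x; flip x], y != z
    & (z == flip y) || (sg y == sg z)].

Definition quads : {set {set 'I_n}} :=
  [set a : {set 'I_n} | [exists x, exists y, exists z,
     (a == [set x; flip x; y; z]) && quad_cond x y z]].

Lemma quadsP a : reflect (exists x y z, a = [set x; flip x; y; z] /\ quad_cond x y z)
  (a \in quads).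
Proof.
rewrite inE; apply: (iffP existsP) => [[x /existsP[y /existsP[z /andP[/eqP -> c]]]]|].
  by exists x, y, z.
case=> x [y [z [-> c]]]; exists x; apply/existsP; exists y; apply/existsP; exists z.
by rewrite eqxx.
Qed.

Lemma quad_condC x y z : quad_cond x y z = quad_cond x z y.
Proof.
rewrite /quad_cond andbCA [z == y]eq_sym [sg z == _]eq_sym.
by rewrite [z == _]eq_sym -(inv_eq flipK) [flip y == z]eq_sym.
Qed.

Lemma quad_cond_flip x y z : quad_cond x y z = quad_cond (flip x) y z.
Proof. by rewrite /quad_cond flipK setUC. Qed.

Lemma quads_card : quads \subset subsets_of_card [set: 'I_n] 4.
Proof.
apply/subsetP => _ /quadsP[x [y [z [-> /and4P[yx zx yz _]]]]].
rewrite inE subsetT /= setUC cardsU1 setUC cardsU1 cards2 yx [x == _]eq_sym flip_neq.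
by rewrite in_setU1 negb_or [z == y]eq_sym yz zx.
Qed.

Section Vertex.
Variable v : 'I_n.
Local Notation D := (subsets_of_card (~: [set v; flip v]) 2).

(* The only pairs whose collapsing facet does not contain [flip v] are the
   [{p, q}] with [sg p <> sg v], [sg q = sg v], [q <> flip p]: [p] is returned. *)
Definition mixed (s : {set 'I_n}) : option 'I_n :=
  [pick p in s | [&& sg p != sg v, flip p \notin s & [exists q in s, sg q == sg v]]].

Definition quad_apex s : 'I_n := if mixed s is Some p then flip p else flip v.
(** Mixed pairs are collapsed first: the link facet [{flip p, p, q}] of a mixed pair also contains
    [{p, flip p}] and [{flip p, q}], which are not mixed and come later. *)
Definition quad_height (s : {set 'I_n}) : nat := if mixed s is Some _ then 0%N else 1%N.

Lemma mixed_None p q : (q == flip p) || (sg p == sg q) -> mixed [set p; q] = None.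
Proof.
move=> c; rewrite /mixed; case: pickP => // x /and4P[xs sx fx /existsP[y /andP[ys sy]]].
move: xs ys fx sx sy; rewrite !inE.
case/orP: c => [/eqP ->|/eqP spq].
  by case/orP=> /eqP ->; rewrite ?flipK eqxx ?orbT.
by case/orP=> /eqP -> /orP[] /eqP ->; rewrite ?spq => _ /negPf ->.
Qed.

Lemma mixed_Some p q : q != flip p -> sg p != sg v -> sg q == sg v ->
  mixed [set p; q] = Some p.
Proof.
move=> qp sp sq; rewrite /mixed; case: pickP => [x /and4P[]|/(_ p)].
  by rewrite !inE => /orP[] /eqP -> //; rewrite sq.
rewrite !inE eqxx sp flip_neq [flip p == q]eq_sym (negPf qp) /=.
by move/existsP; case; exists q; rewrite !inE eqxx orbT.
Qed.

Lemma in_ridges p q : p != q ->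
  ([set p; q] \in D) = [&& p != v, p != flip v, q != v & q != flip v].
Proof.
by move=> pq; rewrite inE cards2 pq subUset !sub1set !inE !negb_or eqxx andbT -andbA.
Qed.

(** A normal form: in the mixed case the two vertices are named so that [p] is the one whose sign
    differs from that of [v]. *)
Lemma ridgeP s : s \in D -> exists p q,
  [/\ s = [set p; q], p != q, [&& p != v, p != flip v, q != v & q != flip v]
    & mixed s = None /\ (q == flip p) || (sg p == sg q) \/
      [/\ mixed s = Some p, q != flip p, sg p != sg v & sg q == sg v]].
Proof.
move=> sD; have /cards2P[p [q [pq sE]]] : #|s| == 2 by move: sD; rewrite inE => /andP[].
move: sD; rewrite sE in_ridges // => out.
have [c|nc] := boolP ((q == flip p) || (sg p == sg q)).
  by exists p, q; split=> //; left; split=> //; apply: mixed_None.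
move: nc; rewrite negb_or => /andP[qp spq].
have [sp|sp] := eqVneq (sg p) (sg v).
  have pq' : p != flip q by rewrite eq_sym (inv_eq flipK).
  have sq : sg q != sg v by rewrite -sp eq_sym.
  exists q, p; split; [by rewrite setUC | by rewrite eq_sym | | right].
    by case/and4P: out => -> -> -> ->.
  by rewrite [[set p; q]]setUC; split=> //; [apply: mixed_Some; rewrite ?sp | rewrite sp].
have sq : sg q == sg v by move: spq sp; case: (sg p) (sg q) (sg v) => -[] [].
by exists p, q; split=> //; right; split=> //; apply: mixed_Some.
Qed.

Lemma quads_tree : tree_link 2 quads v (flip v) quad_apex quad_height.
Proof.
split; first by rewrite flip_neq.
- apply/setP => a; rewrite [LHS]inE; apply/andP/imsetP => [[/quadsP[x [y [z [aE c]]]] va]|].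
    (* First kind of facet through [v]: the distinguished pair is [{v, flip v}]. *)
    have cone (p q : 'I_n) : a = [set v; flip v; p; q] -> quad_cond v p q ->
        exists2 s, s \in D & a = v |: (quad_apex s |: s).
      move=> aE' /and4P[pv qv pq c']; exists [set p; q].
        by move: pv qv; rewrite in_ridges // !inE !negb_or => /andP[-> ->] /andP[-> ->].
      by rewrite /quad_apex mixed_None // aE' !setUA.
    (* Second kind: the distinguished pair avoids [v]; it is oriented so that [x'] has the sign
       opposite to [v]. *)
    have side x' z' : a = [set x'; flip x'; v; z'] -> quad_cond x' v z' ->
        exists2 s, s \in D & a = v |: (quad_apex s |: s).
      wlog sx : x' / sg x' != sg v => [hw|] aE' c'.
        have [sx|sx] := eqVneq (sg x') (sg v); last exact: hw sx aE' c'.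
        apply: (hw (flip x')); rewrite -?quad_cond_flip //.
          by rewrite sg_flip sx; case: (sg v).
        by rewrite flipK [[set flip x'; x']]setUC.
      case/and4P: (c'); rewrite !inE !negb_or => /andP[vx vfx] /andP[zx zfx] vz.
      have vfx' : x' != flip v by rewrite eq_sym (inv_eq flipK).
      (* If [z'] is [flip v], the facet is a union of two flip pairs, hence also of the first kind;
         otherwise its ridge is the mixed pair [{x', z'}]. *)
      case/orP=> [/eqP zE|/eqP sz].
        apply: (cone x' (flip x')).
          by rewrite aE' zE; apply/setP => u; rewrite !inE; do !case: eqP.
        rewrite /quad_cond !inE !negb_or [flip x' == flip v](can_eq flipK) [x' == v]eq_sym vx.
        by rewrite vfx' [flip x' == v]eq_sym vfx [x' == _]eq_sym flip_neq eqxx.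
      exists [set x'; z'].
        rewrite in_ridges ?[x' == z']eq_sym // ![_ == v]eq_sym vx vfx' vz /=.
        by apply: contra_eqN sz => /eqP ->; rewrite sg_flip; case: (sg v).
      rewrite /quad_apex mixed_Some -?sz // aE'.
      by apply/setP => u; rewrite !inE; do !case: eqP.
    move: va; rewrite {1}aE !inE -!orbA => /or4P[] /eqP vE.
    + by apply: (cone y z); rewrite vE.
    + by apply: (cone y z); rewrite vE ?flipK -?quad_cond_flip // [[set flip x; x]]setUC.
    + by apply: (side x z); rewrite vE.
    + by apply: (side x y); rewrite vE ?(quad_condC x z y) // aE setUAC.
  case=> s /ridgeP[p [q [-> pq /and4P[pv pfv qv qfv] [[mE c]|[mE qp sp sq]]]]] ->;
    rewrite /quad_apex mE setU11; split=> //; apply/quadsP.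
    exists v, p, q; split; first by rewrite !setUA.
    by rewrite /quad_cond !inE !negb_or pv pfv qv qfv pq.
  exists p, v, q; split.
    by apply/setP => u; rewrite !inE; do !case: eqP.
  rewrite /quad_cond !inE !negb_or ![v == _]eq_sym pv qv [q == p]eq_sym pq qp.
  by rewrite (inv_eq flipK) pfv [sg v == _]eq_sym sq orbT.
- move=> s /ridgeP[p [q [-> pq /and4P[pv pfv qv qfv] [[mE c]|[mE qp sp sq]]]]];
    rewrite /quad_apex mE !inE !negb_or flip_neq ![flip _ == _]eq_sym.
    by rewrite pfv qfv.
  by rewrite qp -(inv_eq flipK) [flip v == p]eq_sym pfv.
- move=> s t /ridgeP[p [q [-> pq /and4P[pv pfv qv qfv] cs]]].
  move=> /ridgeP[p' [q' [-> pq' _ [[mt _]|[mt qp' sp' sq']]]]];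
    rewrite /quad_apex /quad_height mt.
    move=> sub; left; apply/eqP; rewrite eqEcard !cards2 pq pq' andbT.
    apply/subsetP => u us; have := subsetP sub _ us; rewrite [u \in flip v |: _]in_setU1.
    suff /negPf -> : u != flip v by [].
    by move: us; rewrite !inE => /orP[] /eqP ->.
  case: cs => [[-> _]|[ms qp sp sq] sub]; first by right.
  left; have := subsetP sub p; have := subsetP sub q; rewrite !inE !eqxx orbT.
  move=> /(_ isT) qin /(_ isT) pin.
  (* Among [flip p'], [p'] and [q'], only [p'] has the sign opposite to [v]. *)
  have pE : p = p'.
    case/or3P: pin => /eqP E //; move: sp.
      by rewrite E sg_flip; case: (sg p') (sg v) sp' => -[].
    by rewrite E sq'.
  congr [set _; _] => //; rewrite -pE in qin sp'.
  case/or3P: qin => /eqP // E; first by rewrite E eqxx in qp.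
  by move: sq; rewrite E (negPf sp').
Qed.

End Vertex.
End Antipodal.

(** * Facets for k = 2 *)

Lemma Z3_cases (a b : 'Z_3) : [\/ b = a, b = a + 1 | b = a + 1 + 1].
Proof.
have /forallP/(_ a)/forallP/(_ b) :
    [forall a : 'Z_3, forall b : 'Z_3, [|| b == a, b == a + 1 | b == a + 1 + 1]].
  by apply/forallP=> -[[|[|[|?]]] ?] //; apply/forallP=> -[[|[|[|?]]] ?].
by case/or3P=> /eqP; [constructor 1 | constructor 2 | constructor 3].
Qed.

Lemma Z3_addK (a : 'Z_3) : a + 1 + 1 + 1 = a.
Proof. by apply/eqP; case: a => -[|[|[|?]]] ?. Qed.

Lemma Z3_neq (a : 'Z_3) :
  ((a + 1 == a) = false) * ((a == a + 1) = false) * ((a + 1 + 1 == a) = false) *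
  ((a == a + 1 + 1) = false) * ((a + 1 + 1 == a + 1) = false) * ((a + 1 == a + 1 + 1) = false).
Proof. by case: a => -[|[|[|?]]] ?. Qed.

Section Rotation.
Variables (n : nat) (rot : 'I_n -> 'I_n) (col : 'I_n -> 'Z_3) (lev : 'I_n -> nat).
Hypotheses (col_rot : forall x, col (rot x) = col x + 1)
           (lev_rot : forall x, lev (rot x) = lev x)
           (coord_inj : forall x y, col x = col y -> lev x = lev y -> x = y).

Lemma rotK x : rot (rot (rot x)) = x.
Proof. by apply: coord_inj; rewrite ?lev_rot // !col_rot Z3_addK. Qed.

Lemma same_lev x y : lev y = lev x -> [\/ y = x, y = rot x | y = rot (rot x)].
Proof.
move=> l; case: (Z3_cases (col x) (col y)) => c;
  [constructor 1 | constructor 2 | constructor 3];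
  by apply: coord_inj; rewrite ?lev_rot ?col_rot.
Qed.

Lemma rot_neq x : (rot x == x) = false.
Proof. by apply/eqP => /(congr1 col)/eqP; rewrite col_rot Z3_neq. Qed.

Lemma rot2_neq x : (rot (rot x) == x) = false.
Proof. by apply/eqP => /(congr1 col)/eqP; rewrite !col_rot Z3_neq. Qed.

Lemma lev_neq x y : lev x != lev y -> (x == y) = false.
Proof. by apply: contraNF => /eqP ->. Qed.

Definition triple_cond (x y : 'I_n) : bool :=
  [|| y == rot (rot x), (lev x < lev y)%N && (col y == col x)
    | (lev y < lev x)%N && (col y == col x + 1 + 1)].

Definition triples : {set {set 'I_n}} :=
  [set a : {set 'I_n} | [exists x, exists y, (a == [set x; rot x; y]) && triple_cond x y]].

Lemma triplesP a : reflect (exists x y, a = [set x; rot x; y] /\ triple_cond x y)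
  (a \in triples).
Proof.
rewrite inE; apply: (iffP existsP) => [[x /existsP[y /andP[/eqP -> c]]]|].
  by exists x, y.
by case=> x [y [-> c]]; exists x; apply/existsP; exists y; rewrite eqxx.
Qed.

Lemma triples_card : triples \subset subsets_of_card [set: 'I_n] 3.
Proof.
apply/subsetP => _ /triplesP[x [y [-> c]]].
rewrite inE subsetT /= setUC cardsU1 cards2 [x == _]eq_sym rot_neq.
suff -> : y \notin [set x; rot x] by [].
rewrite !inE negb_or; case/or3P: c => [/eqP ->|/andP[lt _]|/andP[lt _]].
- by rewrite rot2_neq rot_neq.
- by rewrite !lev_neq ?lev_rot // neq_ltn lt orbT.
- by rewrite !lev_neq ?lev_rot // neq_ltn lt.
Qed.

Section Vertex.
Variable v : 'I_n.
Local Notation D := (subsets_of_card (~: [set v; rot v]) 1).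

(** The link of [v] is a tree rooted at [rot v], with edges [{y, parent y}]. On each level other
    than that of [v], one vertex hangs from [rot v], one from [rot (rot v)], and the third from its
    own rotation, which is the one under [rot (rot v)]. *)
Definition parent (y : 'I_n) : 'I_n :=
  if lev y == lev v then rot v
  else if (lev y < lev v)%N then
    if col y == col v then rot y
    else if col y == col v + 1 then rot (rot v) else rot v
  else
    if col y == col v then rot v
    else if col y == col v + 1 then rot y else rot (rot v).

(** Heights increase towards the root: 0 for a vertex hanging from its rotation, 1 for the others
    off the level of [v], 2 for [rot (rot v)]. *)
Definition height (y : 'I_n) : nat :=
  if lev y == lev v then 2%N else (parent y != rot y)%N.

(** For [d = 1] the ridges are singletons; this turns a function on vertices into one on sets, the
    default [v] serving for the empty set. *)
Definition on_elt T (f : 'I_n -> T) (s : {set 'I_n}) : T := f (odflt v [pick y in s]).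

Lemma on_elt1 T (f : 'I_n -> T) y : on_elt f [set y] = f y.
Proof.
rewrite /on_elt; case: pickP => [x|/(_ y)]; rewrite inE; first by move/eqP->.
by rewrite eqxx.
Qed.

Lemma in_ridges1 y : ([set y] \in D) = (y != v) && (y != rot v).
Proof. by rewrite inE cards1 sub1set !inE negb_or andbT. Qed.

Lemma ridgeP1 s : s \in D -> exists y, [/\ s = [set y], y != v, y != rot v &
  y = rot (rot v) \/ lev y != lev v].
Proof.
move=> sD; have /cards1P[y sE] : #|s| == 1%N by move: sD; rewrite inE => /andP[].
move: sD; rewrite sE in_ridges1 => /andP[yv yrv]; exists y; split=> //.
have [l|l] := eqVneq (lev y) (lev v); last by right.
by case: (same_lev l) => E; [rewrite E eqxx in yv | rewrite E eqxx in yrv | left].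
Qed.

Lemma parent_tree : tree_link 1 triples v (rot v) (on_elt parent) (on_elt height).
Proof.
split; first by rewrite rot_neq.
- apply/setP => a; rewrite [LHS]inE; apply/andP/imsetP => [[/triplesP[x [y [aE c]]] va]|].
    have mk z : z != v -> z != rot v -> a = v |: (parent z |: [set z]) ->
        exists2 s, s \in D & a = v |: (on_elt parent s |: s).
      by move=> zv zrv aE'; exists [set z]; rewrite ?in_ridges1 ?zv // on_elt1.
    move: va; rewrite {1}aE !inE -!orbA.
    (* The facet is a whole level, so it is the level of [v], with ridge [{rot (rot v)}]. *)
    have [yE|yN] := eqVneq y (rot (rot x)).
      move=> vx; apply: (mk (rot (rot v))); rewrite ?rot2_neq ?rot_neq //.
      rewrite /parent !lev_rot eqxx aE yE.
      case/or3P: vx => /eqP ->; rewrite ?yE ?rotK; apply/setP=> u; rewrite !inE;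
        by do !case: eqP.
    have xy_lev : lev x != lev y.
      move: c; rewrite /triple_cond (negPf yN) neq_ltn /=.
      by case/orP=> /andP[-> _]; rewrite ?orbT.
    have lev_out z : lev z != lev v -> z != v /\ z != rot v.
      by move=> zl; rewrite !lev_neq ?lev_rot.
    move: c; rewrite /triple_cond (negPf yN) /= => c.
    (* [v] is [x], [rot x] or [y]. The ridge is the vertex off the level of [v], or, when [v] is
       [y], the vertex [x] that hangs from [rot x]. *)
    case/or3P => /eqP vE.
    + have [yv yrv] : y != v /\ y != rot v by apply: lev_out; rewrite vE eq_sym.
      apply: (mk y) => //.
      rewrite (_ : parent y = rot v) ?aE ?vE ?setUA //.
      rewrite /parent vE eq_sym (negPf xy_lev).
      case/orP: c => /andP[lt /eqP ->]; last by rewrite lt !Z3_neq.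
      by rewrite ltnNge ltnW //= eqxx.
    + have [yv yrv] : y != v /\ y != rot v by apply: lev_out; rewrite vE lev_rot eq_sym.
      apply: (mk y) => //.
      have xE : x = rot (rot v) by rewrite vE rotK.
      rewrite (_ : parent y = x); last first.
        rewrite /parent xE; move: xy_lev c; rewrite xE !lev_rot !col_rot Z3_addK eq_sym.
        move=> /negPf -> /orP[] /andP[lt /eqP ->]; last by rewrite lt !Z3_neq eqxx.
        by rewrite ltnNge ltnW //= !Z3_neq.
      by rewrite aE -vE; apply/setP=> u; rewrite !inE; do !case: eqP.
    + have [xv xrv] : x != v /\ x != rot v by apply: lev_out; rewrite vE.
      apply: (mk x) => //.
      rewrite (_ : parent x = rot x); last first.
        rewrite /parent vE (negPf xy_lev).
        case/orP: c => /andP[lt /eqP ->]; first by rewrite lt eqxx.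
        by rewrite ltnNge ltnW //= Z3_addK !Z3_neq eqxx.
      by rewrite aE -vE; apply/setP=> u; rewrite !inE; do !case: eqP.
  case=> s /ridgeP1[y [-> yv yrv cs]] ->; rewrite on_elt1 setU11; split=> //.
  apply/triplesP; rewrite /parent.
  have perm3 (b c d : 'I_n) : [set b; c; d] = d |: (b |: [set c]).
    by apply/setP=> u; rewrite !inE; do !case: eqP.
  case: cs => [->|lne].
    exists v, (rot (rot v)); rewrite !lev_rot eqxx /triple_cond eqxx.
    by rewrite setUA.
  rewrite (negPf lne); move: lne; rewrite neq_ltn => /orP[] lt.
    rewrite lt; case: (Z3_cases (col v) (col y)) => cy; rewrite cy ?Z3_neq ?eqxx.
    + exists y, v; split; first by apply/setP=> u; rewrite !inE; do !case: eqP.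
      by rewrite /triple_cond lt cy eqxx orbT.
    + exists (rot (rot v)), y; rewrite rotK; split.
        by apply/setP=> u; rewrite !inE; do !case: eqP.
      by rewrite /triple_cond !lev_rot !col_rot lt cy !Z3_addK eqxx !orbT.
    + exists v, y; split; first by rewrite setUA.
      by rewrite /triple_cond lt cy eqxx !orbT.
  rewrite ltnNge ltnW //=; case: (Z3_cases (col v) (col y)) => cy; rewrite cy ?Z3_neq ?eqxx.
  + exists v, y; split; first by rewrite setUA.
    by rewrite /triple_cond lt cy eqxx !orbT.
  + exists y, v; split; first by apply/setP=> u; rewrite !inE; do !case: eqP.
    by rewrite /triple_cond lt cy Z3_addK eqxx !orbT.
  + exists (rot (rot v)), y; rewrite rotK; split.
      by apply/setP=> u; rewrite !inE; do !case: eqP.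
    by rewrite /triple_cond !lev_rot !col_rot lt cy eqxx !orbT.
- move=> s /ridgeP1[y [-> yv yrv cs]]; rewrite on_elt1 !inE negb_or /parent.
  case: cs => [->|lne].
    by rewrite !lev_rot eqxx rot_neq [rot v == _]eq_sym rot_neq.
  have lne' : lev v != lev y by rewrite eq_sym.
  by rewrite (negPf lne); do !case: ifP => _;
    rewrite ?rot_neq ?rot2_neq ?[rot _ == _]lev_neq ?lev_rot.
move=> s t /ridgeP1[y [-> yv yrv cs]] /ridgeP1[z [-> zv zrv cz]].
rewrite !on_elt1 sub1set !inE => /orP[/eqP yE|/eqP ->]; last by left.
right; case: cz => [zE|lz].
  by move: yrv; rewrite yE /parent zE !lev_rot eqxx eqxx.
have hz : height z = (parent z != rot z) by rewrite /height (negPf lz).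
(* A parent of [z] other than [rot z] is on the level of [v], so [y] then has height 2. *)
rewrite hz; have [pz|pz] := eqVneq (parent z) (rot z); last first.
  suff ly : lev y == lev v by rewrite /height ly; case: (parent z == _).
  by rewrite yE; move: pz; rewrite /parent; do !case: ifP => _; rewrite ?eqxx ?lev_rot ?eqxx.
have ryz : lev y != lev v by rewrite yE pz lev_rot.
rewrite /= /height (negPf ryz) lt0b /parent (negPf ryz).
have -> : lev y = lev z by rewrite yE pz lev_rot.
have -> : col y = col z + 1 by rewrite yE pz col_rot.
(* For each colour of [z], either the parent of [rot z] is on the level of [v], or that of [z] is,
   contradicting [parent z = rot z]. *)
move: pz; rewrite /parent (negPf lz).
case: ifP => lt; case: (Z3_cases (col v) (col z)) => ->;
  rewrite ?Z3_addK ?Z3_neq ?eqxx => pz;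
  first [ by rewrite lev_neq // !lev_rot eq_sym
        | by case/eqP: lz; rewrite -(lev_rot z) -pz !lev_rot ].
Qed.

End Vertex.
End Rotation.

(** * Concrete vertex sets with an involution or a rotation *)

Section RevOrd.
Variable m : nat.
Definition low_half (x : 'I_m.*2) : bool := (x < m)%N.

Lemma low_half_rev x : low_half (rev_ord x) = ~~ low_half x.
Proof. by have := ltn_ord x; rewrite /low_half /=; lia. Qed.
End RevOrd.

Section Grid.
Variable m : nat.
Local Notation V := 'I_#|{: 'Z_3 * 'I_m}|.
(** Vertices must form an ordinal, so Z/3 x [m] is transported along its enumeration. *)
Definition grid_col (x : V) : 'Z_3 := (enum_val x).1.
Definition grid_lev (x : V) : nat := (enum_val x).2.
Definition grid_rot (x : V) : V := enum_rank ((enum_val x).1 + 1, (enum_val x).2).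

Lemma grid_col_rot x : grid_col (grid_rot x) = grid_col x + 1.
Proof. by rewrite /grid_col enum_rankK. Qed.

Lemma grid_lev_rot x : grid_lev (grid_rot x) = grid_lev x.
Proof. by rewrite /grid_lev enum_rankK. Qed.

Lemma grid_coord_inj x y : grid_col x = grid_col y -> grid_lev x = grid_lev y -> x = y.
Proof.
rewrite /grid_col /grid_lev => c /val_inj l; apply: enum_val_inj.
by rewrite [LHS]surjective_pairing c l -surjective_pairing.
Qed.
End Grid.

Theorem theorem6 (K : fieldType) (k : nat) (hk : (1 <= k <= 3)%N) :
  forall N : nat, exists n : nat, (N < n)%N /\
    exists J : {set {set 'I_n}},
      [/\ is_complex J,
          skeleton (full_simplex n) (k%:Z - 1) \subset J,
          J \subset skeleton (full_simplex n) k%:Z,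
          forall v : 'I_n, betti K (link J [set v]) (k%:Z - 2) = 0%N
        & (betti K J (k%:Z - 1))%:R = 1 / (k.+1)%:R * 'C(n - 2, k)%:R :> rat].
Proof.
move=> N; case: k hk => [|[|[|[|k]]]] // _.
(* On an even number of vertices, [rev_ord] exchanges the lower and upper halves, which provide the
   signs. *)
- exists N.+1.*2; split; first by lia.
  exists (with_skeleton 0 (matching (@rev_ord _))); apply: with_skeleton_spec => [||v].
  + exact: (matching_card (@low_half_rev _)).
  + by rewrite double_gt0.
  + by do 3!eexists; apply: (matching_tree rev_ordK (@low_half_rev _)).
- have Nn : (N < #|{: 'Z_3 * 'I_N.+1}|)%N by rewrite card_prod !card_ord; lia.
  exists #|{: 'Z_3 * 'I_N.+1}|; split=> //.
  exists (with_skeleton 1 (triples (@grid_rot _) (@grid_col _) (@grid_lev _))).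
  apply: with_skeleton_spec => [||v].
  + exact: (triples_card (@grid_col_rot _) (@grid_lev_rot _)).
  + exact: leq_trans Nn.
  + by do 3!eexists; apply: (parent_tree (@grid_col_rot _) (@grid_lev_rot _) (@grid_coord_inj _)).
- exists N.+1.*2; split; first by lia.
  exists (with_skeleton 2 (quads (@rev_ord _) (@low_half _))); apply: with_skeleton_spec => [||v].
  + exact: (quads_card (@low_half_rev _)).
  + by rewrite double_gt0.
  + by do 3!eexists; apply: (quads_tree rev_ordK (@low_half_rev _)).
Qed.
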